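(* Let $\Pi$ be a GSP of an SF instance $I$, and let $a_i\neq a_j$ be fully matched in the half-matching associated with $\Pi$, i.e. $|\{s:\Pi_s(a_i)=a_j\}|+|\{s:\Pi_s(a_j)=a_i\}|=2$. Then there exists a permutation $\Pi_r\in\Pi$ such that $\Pi_r=(a_i\ a_j)$.
   Context: A Stable Fixtures (SF) instance is $I=(A,\succ,c)$ where $A=\{a_1,\dots,a_n\}$ is a finite set of $n$ agents; each agent $a_i$ has a strict linear order $\succ_i$ over $A\setminus\{a_i\}$ (complete preference list), with the convention that every agent ranks itself last ($a_j\succ_i a_i$ for all $j\neq i$); $a\succeq_i b$ means $a\succ_i b$ or $a=b$. Each agent has an integer capacity $c_i$ with $1\le c_i<n$. A cyclic permutation of a nonempty set $A_r\subseteq A$ is a permutation $\Pi_r$ of $A_r$ consisting of a single cycle of length $|A_r|$ (length 1: a fixed point $(a_i)$; length 2: a transposition $(a_i\ a_j)$). Two cyclic permutations are distinct if some element is mapped to different elements by them. A GSP (generalised stable partition) of $I$ is a finite collection $\Pi=\{\Pi_1,\dots,\Pi_k\}$ of cyclic permutations $\Pi_r$ of sets $A_r\subseteq A$, pairwise distinct except that fixed points may be repeated, such that: (F1) for every $r$ and every $a_j\in A_r$, $\Pi_r(a_j)\succeq_j\Pi_r^{-1}(a_j)$; (F2) there are no distinct $a_i,a_j\in A$ with the transposition $(a_i\ a_j)\notin\Pi$ such that $a_j\succ_i\Pi_r^{-1}(a_i)$ and $a_i\succ_j\Pi_s^{-1}(a_j)$ for some $\Pi_r,\Pi_s\in\Pi$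 with $a_i\in A_r$, $a_j\in A_s$; (F3) for every $a_i\in A$, the number of indices $r$ with $a_i\in A_r$ equals $c_i$; (F4) for all distinct $a_i,a_j\in A$, $|\{s:\Pi_s(a_i)=a_j\}|+|\{s:\Pi_s(a_j)=a_i\}|\le 2$. In the half-matching associated with $\Pi$, each predecessor–successor pair $\{a,\Pi_r(a)\}$ ($a\in A_r$, $\Pi_r(a)\neq a$) in a cycle counts as a half-match, and two half-matches between the same two agents form a full match. *)

(* Defs.v *)
From HB Require Import structures.
From mathcomp Require Import all_boot all_fingroup.

Set Implicit Arguments.
Unset Strict Implicit.
Unset Printing Implicit Defensive.

(* [prefers i a b] reads a \succ_i b.  The order ranks all agents, with agent i
   itself at the bottom of its own ranking, so its restriction to the other
   agents is the complete strict preference list of i. *)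
Record sf_instance (n : nat) := SFInstance {
  prefers : 'I_n -> rel 'I_n;
  capacity : 'I_n -> nat;
  prefers_irr : forall i, irreflexive (prefers i);
  prefers_trans : forall i, transitive (prefers i);
  prefers_total : forall i a b, a != b -> prefers i a b || prefers i b a;
  prefers_self_last : forall i j, j != i -> prefers i j i;
  capacity_bounds : forall i, 1 <= capacity i < n
}.

Definition weakly_prefers n (I : sf_instance n) (i a b : 'I_n) : bool :=
  prefers I i a b || (a == b).

(* A permutation of the nonempty set [agents_of] consisting of one cycle. It is
   extended by the identity to all agents; the set has to be recorded because
   every fixed point (a) is extended to the same permutation 1. *)
Record cyclic_perm (n : nat) := CyclicPerm {
  agents_of : {set 'I_n};
  perm_of_cycle :> {perm 'I_n};
  agents_of_neq0 : agents_of != set0;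
  perm_on_agents_of : perm_on agents_of perm_of_cycle;
  single_cycle :
    forall a, a \in agents_of -> porbit perm_of_cycle a = agents_of
}.

Definition predecessor n (P : cyclic_perm n) (a : 'I_n) : 'I_n :=
  ((perm_of_cycle P)^-1)%g a.

Definition is_transposition n (P : cyclic_perm n) (a b : 'I_n) : bool :=
  [&& a != b, agents_of P == [set a; b] & perm_of_cycle P == tperm a b].

(* A collection of cyclic permutations is a family indexed by 'I_k, so that
   fixed points can be repeated. *)
Definition nb_mapped n k (Pi : 'I_k -> cyclic_perm n) (a b : 'I_n) : nat :=
  #|[set s | (a \in agents_of (Pi s)) && (Pi s a == b)]|.

(* The number of half-matches between a and b, when a != b. *)
Definition half_matches n k (Pi : 'I_k -> cyclic_perm n) (a b : 'I_n) : nat :=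
  nb_mapped Pi a b + nb_mapped Pi b a.

Definition fully_matched n k (Pi : 'I_k -> cyclic_perm n) (a b : 'I_n) : Prop :=
  half_matches Pi a b = 2.

(* Since permutations are extended by the identity, [gsp_distinct] is only
   required when one of the two cycles is not a fixed point; it then also
   separates cycles on different sets of agents. *)
Record is_gsp n k (Pi : 'I_k -> cyclic_perm n) (I : sf_instance n) : Prop := IsGSP {
  gsp_distinct : forall r s, r != s -> 1 < #|agents_of (Pi r)| ->
    exists a, Pi r a != Pi s a;
  gsp_F1 : forall r a, a \in agents_of (Pi r) ->
    weakly_prefers I a (Pi r a) (predecessor (Pi r) a);
  gsp_F2 : ~ exists a b, [/\ a != b,
    ~ (exists r, is_transposition (Pi r) a b) &
    exists r s, [/\ a \in agents_of (Pi r), b \in agents_of (Pi s),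
      prefers I a b (predecessor (Pi r) a) & prefers I b a (predecessor (Pi s) b)]];
  gsp_F3 : forall a, #|[set r | a \in agents_of (Pi r)]| = capacity I a;
  gsp_F4 : forall a b, a != b -> half_matches Pi a b <= 2
}.

(* Main.v *)
(** If [Pi] contains no transposition of the two ends of an arc a -> b lying on
    a cycle of length at least 3, then a strictly prefers b to its own
    predecessor, so stability forces a to be the worst predecessor of b over
    all cycles through b.  By the bound on half-matches, such a transposition
    never exists.  Hence predecessors in long cycles are determined by the agent
    alone, and two long cycles sharing an agent coincide.  A full match realised
    by two parallel arcs contradicts this; one realised by two opposite arcs
    would be a blocking pair. *)

Require Import Defs.
From HB Require Import structures.
From mathcomp Require Import all_boot all_fingroup.

Set Implicit Arguments.
Unset Strict Implicit.
Unset Printing Implicit Defensive.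

Lemma prefers_asym n (I : sf_instance n) i a b :
  prefers I i a b -> ~~ prefers I i b a.
Proof.
by move=> ab; apply/negP => /(prefers_trans ab); rewrite prefers_irr.
Qed.

Lemma weakly_prefers_anti n (I : sf_instance n) i a b :
  weakly_prefers I i a b -> weakly_prefers I i b a -> a = b.
Proof.
case/orP=> [ab|/eqP//]; case/orP=> [|/eqP//].
by rewrite (negPf (prefers_asym ab)).
Qed.

Section CyclicPerm.
Variable n : nat.
Implicit Types (P Q : cyclic_perm n) (a b : 'I_n).

Lemma mem_image P a : (P a \in agents_of P) = (a \in agents_of P).
Proof. exact: perm_closed (perm_on_agents_of P). Qed.

Lemma predecessorK P a : P (predecessor P a) = a.
Proof. exact: permKV. Qed.

Lemma mem_predecessor P a : (predecessor P a \in agents_of P) = (a \in agents_of P).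
Proof. by rewrite -mem_image predecessorK. Qed.

Lemma mem_moved P a b : a != b -> P a = b -> a \in agents_of P.
Proof.
move=> ab Pab; apply/negPn/negP => /(out_perm (perm_on_agents_of P)) Pa.
by rewrite -Pab Pa eqxx in ab.
Qed.

(** A single cycle is also one orbit of its inverse, so stepping back from [a] reaches every agent
    of the cycle. *)
Lemma agents_ind P (C : 'I_n -> Prop) a :
  a \in agents_of P -> C a ->
  (forall b, b \in agents_of P -> C b -> C (predecessor P b)) ->
  forall b, b \in agents_of P -> C b.
Proof.
move=> aP Ca step b; rewrite -(single_cycle aP) -porbitV => /porbitP[i ->].
set p := ((perm_of_cycle P)^-1)%g.
suff [] : (p ^+ i)%g a \in agents_of P /\ C ((p ^+ i)%g a) by [].
elim: i => [|i [mem IH]]; first by rewrite expg0 perm1.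
by rewrite expgSr permM; split; [rewrite [_ \in _]mem_predecessor | apply: step].
Qed.

(** Length at least 3: a fixed point or a transposition returns to [a] after two steps. *)
Definition long P := [forall a in agents_of P, P (P a) != a].

Lemma is_transposition_sym P a b : is_transposition P a b = is_transposition P b a.
Proof. by rewrite /is_transposition eq_sym setUC tpermC. Qed.

Lemma transposition_image P a b :
  is_transposition P a b -> (a \in agents_of P) && (P a == b).
Proof.
by case/and3P=> _ /eqP-> /eqP->; rewrite !inE eqxx tpermL eqxx.
Qed.

(** Both [P (P a) = a] and its negation propagate around the cycle, so the test at one agent decides
    for all. *)
Lemma transposition_or_long P a b :
  a != b -> P a = b -> is_transposition P a b \/ long P.
Proof.
move=> ab Pab; have aP := mem_moved ab Pab.
have [PPa|PPa] := eqVneq (P (P a)) a; [left | right].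
  have bP : b \in agents_of P by rewrite -Pab mem_image.
  have Pb : P b = a by rewrite -{1}Pab.
  have sub : agents_of P = [set a; b].
    apply/eqP; rewrite eqEsubset; apply/andP; split; apply/subsetP => x; last first.
      by case/set2P=> ->.
    move: x; apply: (agents_ind aP); first by rewrite !inE eqxx.
    move=> x _ /set2P[] ->.
      by rewrite -[in predecessor _ _]Pb /predecessor permK !inE eqxx orbT.
    by rewrite -[in predecessor _ _]Pab /predecessor permK !inE eqxx.
  rewrite /is_transposition ab sub eqxx /=; apply/eqP/permP => x.
  case: tpermP => [->|->|/eqP xa /eqP xb] //.
  by rewrite (out_perm (perm_on_agents_of P)) // sub !inE negb_or xa.
apply/forall_inP; apply: (agents_ind aP) => // x _; apply: contra => /eqP Px.
by rewrite -[x in P (P x)](predecessorK P) Px predecessorK.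
Qed.

Lemma long_image_neq P a : long P -> a \in agents_of P -> P a != a.
Proof.
by move=> /forall_inP L /L; apply: contra => /eqP Pa; rewrite !Pa.
Qed.

Lemma long_card_gt1 P : long P -> 1 < #|agents_of P|.
Proof.
move=> L; have /set0Pn[a aP] := agents_of_neq0 P.
apply/card_gt1P; exists (P a), a.
by rewrite mem_image aP (long_image_neq L).
Qed.

(** Walking backwards from the shared agent never leaves the common agents, so agreement there
    already forces equal agent sets. *)
Lemma eq_cyclic_perm P Q a :
  a \in agents_of P -> a \in agents_of Q ->
  (forall b, b \in agents_of P -> b \in agents_of Q ->
    predecessor P b = predecessor Q b) ->
  P =1 Q.
Proof.
move=> aP aQ eqPQ.
have subPQ b : b \in agents_of P -> b \in agents_of Q.
  move: b; apply: (agents_ind aP) => // b bP bQ.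
  by rewrite eqPQ // mem_predecessor.
have subQP b : b \in agents_of Q -> b \in agents_of P.
  move: b; apply: (agents_ind aQ) => // b bQ bP.
  by rewrite -eqPQ // mem_predecessor.
move=> x; have [xP|xP] := boolP (x \in agents_of P).
  have PxP : P x \in agents_of P by rewrite mem_image.
  rewrite -[RHS](_ : Q (predecessor P (P x)) = _); last by rewrite /predecessor permK.
  by rewrite eqPQ ?predecessorK ?subPQ.
have xQ : x \notin agents_of Q by apply: contra xP; apply: subQP.
by rewrite (out_perm (perm_on_agents_of P)) ?(out_perm (perm_on_agents_of Q)).
Qed.

End CyclicPerm.

Section StablePartition.
Variables (n : nat) (I : sf_instance n) (k : nat) (Pi : 'I_k -> cyclic_perm n).
Hypothesis Pi_gsp : is_gsp Pi I.
Implicit Types (r s : 'I_k) (a b : 'I_n).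

Lemma long_prefers_image r a : long (Pi r) -> a \in agents_of (Pi r) ->
  prefers I a (Pi r a) (predecessor (Pi r) a).
Proof.
move=> /forall_inP L ar; case/orP: (gsp_F1 Pi_gsp ar) => // /eqP E.
by have := L a ar; rewrite E predecessorK eqxx.
Qed.

(** A transposition already supplies two half-matches, one each way; the long arc would be a third,
    against [gsp_F4]. *)
Lemma long_arc_no_transposition r s a :
  long (Pi r) -> a \in agents_of (Pi r) -> ~~ is_transposition (Pi s) a (Pi r a).
Proof.
move=> L ar; apply/negP => T.
have ab : a != Pi r a by rewrite eq_sym long_image_neq.
have rs : r != s.
  apply: contraTneq T => <-; apply/negP => /and3P[_ _ /eqP E].
  have := congr1 (fun p : {perm _} => p (Pi r a)) E; rewrite /= tpermR => /eqP.
  by apply/negP; move/forall_inP: L; apply.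
have := gsp_F4 Pi_gsp ab; apply/negP; rewrite -ltnNge /half_matches -addn1.
(* Two arcs from [a] to [Pi r a], in [r] and [s], and one arc back, in [s]. *)
apply: leq_add.
  apply/card_gt1P; exists r, s; split=> //; rewrite inE ?ar ?eqxx //.
  exact: transposition_image.
apply/card_gt0P; exists s; rewrite inE; apply: transposition_image.
by rewrite is_transposition_sym.
Qed.

(** Otherwise [b] prefers [a] to its predecessor in [s], while [a] prefers its image [b] to its own
    predecessor in [r]: a blocking pair. *)
Lemma long_predecessor_worst r s b :
  long (Pi r) -> b \in agents_of (Pi r) -> b \in agents_of (Pi s) ->
  weakly_prefers I b (predecessor (Pi s) b) (predecessor (Pi r) b).
Proof.
move=> L br bs; set a := predecessor (Pi r) b.
have ar : a \in agents_of (Pi r) by rewrite mem_predecessor.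
have Eab : Pi r a = b by exact: predecessorK.
rewrite /weakly_prefers; have [//|neq] := eqVneq; first by rewrite orbT.
rewrite orbF; case/orP: (prefers_total I b neq) => // block.
case: (gsp_F2 Pi_gsp); exists a, b; split.
- by rewrite -Eab eq_sym long_image_neq.
- by case=> t; rewrite -Eab; apply/negP/long_arc_no_transposition.
- exists r, s; split=> //.
  by have := long_prefers_image L ar; rewrite Eab.
Qed.

(** At each shared agent both predecessors are worst, hence equal by antisymmetry; the cycles then
    coincide, against [gsp_distinct]. *)
Lemma long_cycles_disjoint r s b :
  long (Pi r) -> long (Pi s) ->
  b \in agents_of (Pi r) -> b \in agents_of (Pi s) -> r = s.
Proof.
move=> Lr Ls br bs; apply/eqP/negPn/negP => rs.
have [x] := gsp_distinct Pi_gsp rs (long_card_gt1 Lr).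
rewrite (eq_cyclic_perm br bs) ?eqxx // => c cr cs.
by apply: (@weakly_prefers_anti _ I c); apply: long_predecessor_worst.
Qed.

Lemma parallel_arcs_transposition a b :
  a != b -> 1 < nb_mapped Pi a b -> exists r, is_transposition (Pi r) a b.
Proof.
move=> ab /card_gt1P[r [s []]]; rewrite !inE.
move=> /andP[ar /eqP Er] /andP[as_ /eqP Es] rs.
case: (transposition_or_long ab Er) => [|Lr]; first by exists r.
case: (transposition_or_long ab Es) => [|Ls]; first by exists s.
by rewrite (long_cycles_disjoint Lr Ls ar as_) eqxx in rs.
Qed.

Lemma opposite_arcs_transposition a b :
  a != b -> 0 < nb_mapped Pi a b -> 0 < nb_mapped Pi b a ->
  exists r, is_transposition (Pi r) a b.
Proof.
move=> ab /card_gt0P[r]; rewrite inE => /andP[ar /eqP Er].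
move=> /card_gt0P[s]; rewrite inE => /andP[bs /eqP Es].
case: (transposition_or_long ab Er) => [|Lr]; first by exists r.
have ba : b != a by rewrite eq_sym.
case: (transposition_or_long ba Es) => [|Ls].
  by exists s; rewrite is_transposition_sym.
(* Each of [a] and [b] is the image of the other in a long cycle, so each prefers the other to its
   predecessor there. *)
case: (gsp_F2 Pi_gsp); exists a, b; split=> //.
  by case=> t; rewrite -Er; apply/negP/long_arc_no_transposition.
exists r, s; split=> //.
  by rewrite -[X in prefers _ _ X]Er; apply: long_prefers_image.
by rewrite -[X in prefers _ _ X]Es; apply: long_prefers_image.
Qed.

End StablePartition.

Theorem theorem4 (n : nat) (I : sf_instance n) (k : nat)
    (Pi : 'I_k -> cyclic_perm n) (Pi_gsp : is_gsp Pi I) (ai aj : 'I_n)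
    (ai_neq_aj : ai != aj) (ai_aj_full : fully_matched Pi ai aj) :
  exists r : 'I_k, is_transposition (Pi r) ai aj.
Proof.
have [ij2|ij1] := ltnP 1 (nb_mapped Pi ai aj).
  exact: parallel_arcs_transposition Pi_gsp _ _ ai_neq_aj ij2.
have [ji2|ji1] := ltnP 1 (nb_mapped Pi aj ai).
  have aj_neq_ai : aj != ai by rewrite eq_sym.
  have [r T] := parallel_arcs_transposition Pi_gsp aj_neq_ai ji2.
  by exists r; rewrite is_transposition_sym.
(* Two counts of at most 1 with sum 2 are both 1, which leaves one arc in each direction. *)
move: ai_aj_full ij1 ji1; rewrite /fully_matched /half_matches.
case E1: (nb_mapped Pi ai aj) => [|[|]] //; case E2: (nb_mapped Pi aj ai) => [|[|]] // _ _ _.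
by apply: (opposite_arcs_transposition Pi_gsp); rewrite ?E1 ?E2.
Qed.
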